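(* Let $\mathcal{A}=\{A_0,A_1,A_2\}$ be the standard basis of a symmetric rank $3$ standard integral table algebra with character table $[1,k,\ell;\,1,r,-1-r;\,1,s,-1-s]$. (i) If $k=s^2$, $\ell=-2s$ and $r=1$, then the partition $249|37|5|68$ of $\{2,\dots,9\}$ gives a fusion of $\mathcal{A}\otimes\mathcal{A}$. (ii) If $k=2(1+r)$, $\ell=(1+r)^2$ and $s=-2$, then the partition $24|375|68|9$ gives a fusion of $\mathcal{A}\otimes\mathcal{A}$.
   Context: A symmetric rank $3$ standard integral table algebra is a commutative associative complex algebra with basis $A_0=1,A_1,A_2$ such that the structure constants $\lambda_{ijh}$ ($A_iA_j=\sum_h\lambda_{ijh}A_h$) are nonnegative reals, $\lambda_{ij0}=0$ for $i\neq j$, and $\lambda_{ii0}=\delta(A_i)$ is a positive integer, where $\delta$ is the valency homomorphism. Main example: $A_0=I_n$, $A_1$ the adjacency matrix of a strongly regular graph, $A_2=J-I-A_1$. Here $k=\delta(A_1)$, $\ell=\delta(A_2)$, and the character table has rows the characters $\chi_0=\delta,\chi_1,\chi_2$ and columns $A_0,A_1,A_2$. The tensor square $\mathcal{A}\otimes\mathcal{A}$ has basis $A_{ij}=A_i\otimes A_j$, relabelled $C_{3j+i+1}=A_{ij}$: $C_1=A_{00},C_2=A_{10},C_3=A_{20},C_4=A_{01},C_5=A_{11},C_6=A_{21},C_7=A_{02},C_8=A_{12},C_9=A_{22}$. Partitions of $\{2,\dots,9\}$ are written with blocks separated by bars. A partition $\tau$ gives a fusion of $\mathcal{A}\otimes\mathcal{A}$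 if the span of $C_1$ and the block sums $\sum_{t\in T}C_t$ ($T$ a block of $\tau$) is closed under multiplication. *)

(* Defs.v *)
From HB Require Import structures.
From mathcomp Require Import all_boot all_order all_algebra all_field.
From mathcomp Require Import reals complex.

Set Implicit Arguments.
Unset Strict Implicit.
Unset Printing Implicit Defensive.
Import Order.TTheory GRing.Theory Num.Theory.
Local Open Scope ring_scope.

(* The tensor product of two finite-dimensional algebras, realised as the    *)
(* matrices of coordinates on the products of the elements of a basis of A   *)
(* and a basis of B. [tensor_lift_tens] and [tensor_ext] give the universal  *)
(* property, [tensM] and [tens1] determine the algebra structure.            *)
Definition tensor (K : fieldType) (A B : vectType K) : Type :=
  'M[K]_(\dim {:A}, \dim {:B}).

HB.instance Definition _ (K : fieldType) (A B : vectType K) :=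
  Vector.copy (tensor A B) 'M[K]_(\dim {:A}, \dim {:B}).

Definition tens (K : fieldType) (A B : vectType K) (a : A) (b : B) :
    tensor A B :=
  \matrix_(i < \dim {:A}, j < \dim {:B})
    (coord (vbasis {:A}) i a * coord (vbasis {:B}) j b).

Definition tensor_lift (K : fieldType) (A B V : vectType K) (g : A -> B -> V)
    (x : tensor A B) : V :=
  \sum_(i < \dim {:A}) \sum_(j < \dim {:B})
    (x : 'M[K]_(\dim {:A}, \dim {:B})) i j *:
      g (vbasis {:A})`_i (vbasis {:B})`_j.

Section TensorVector.
Variables (K : fieldType) (A B V : vectType K).
Implicit Types (g h : A -> B -> V) (x y : tensor A B).

Lemma tens_linearl b : linear (fun a : A => tens a b : tensor A B).
Proof.
by move=> c a a'; apply/matrixP => i j; rewrite !mxE linearP /= mulrDl mulrA.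
Qed.

Lemma tens_linearr a : linear (fun b : B => tens a b : tensor A B).
Proof.
move=> c b b'; apply/matrixP => i j.
by rewrite !mxE linearP /= mulrDr mulrCA.
Qed.

Lemma tensor_lift_linear g : linear (tensor_lift g).
Proof.
move=> c x y; rewrite /tensor_lift scaler_sumr -big_split /=.
apply: eq_bigr => i _; rewrite scaler_sumr -big_split /=.
by apply: eq_bigr => j _; rewrite !mxE scalerDl scalerA.
Qed.

Lemma tensor_lift_linear_fun c g h x :
  tensor_lift (fun a b => c *: g a b + h a b) x =
  c *: tensor_lift g x + tensor_lift h x.
Proof.
rewrite /tensor_lift scaler_sumr -big_split /=.
apply: eq_bigr => i _; rewrite scaler_sumr -big_split /=.
by apply: eq_bigr => j _; rewrite scalerDr !scalerA mulrC.
Qed.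

Lemma eq_tensor_lift g h x :
  (forall a b, g a b = h a b) -> tensor_lift g x = tensor_lift h x.
Proof. by move=> gh; apply: eq_bigr => i _; apply: eq_bigr => j _; rewrite gh. Qed.

Lemma tensor_lift_tens g a b :
  (forall a', linear (g a')) -> (forall b', linear (g^~ b')) ->
  tensor_lift g (tens a b) = g a b.
Proof.
move=> gr gl.
pose mr a' := GRing.isLinear.Build K B V *:%R (g a') (gr a').
pose ml b' := GRing.isLinear.Build K A V *:%R (g^~ b') (gl b').
pose Gr a' : {linear B -> V} := HB.pack (g a') (mr a').
pose Gl b' : {linear A -> V} := HB.pack (g^~ b') (ml b').
have eB : b = \sum_j coord (vbasis {:B}) j b *: (vbasis {:B})`_j.
  exact: coord_vbasis (memvf b).
have eA : a = \sum_i coord (vbasis {:A}) i a *: (vbasis {:A})`_i.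
  exact: coord_vbasis (memvf a).
have -> : g a b = \sum_i coord (vbasis {:A}) i a *: g (vbasis {:A})`_i b.
  rewrite -[LHS]/(Gl b a) {1}eA linear_sum; apply: eq_bigr => i _.
  by rewrite linearZ.
apply: eq_bigr => i _; set u := (vbasis {:A})`_i.
have -> : g u b = \sum_j coord (vbasis {:B}) j b *: g u (vbasis {:B})`_j.
  rewrite -[LHS]/(Gr u b) {1}eB linear_sum; apply: eq_bigr => j _.
  by rewrite linearZ.
by rewrite scaler_sumr; apply: eq_bigr => j _; rewrite mxE scalerA.
Qed.

Lemma tensor_ext (f h : tensor A B -> V) : linear f -> linear h ->
  (forall a b, f (tens a b) = h (tens a b)) -> f =1 h.
Proof.
move=> fl hl fh x.
pose F : {linear tensor A B -> V} :=
  HB.pack f (GRing.isLinear.Build K (tensor A B) V *:%R f fl).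
pose H : {linear tensor A B -> V} :=
  HB.pack h (GRing.isLinear.Build K (tensor A B) V *:%R h hl).
have -> : x = \sum_i \sum_j (x : 'M[K]_(\dim {:A}, \dim {:B})) i j *:
    tens (vbasis {:A})`_i (vbasis {:B})`_j.
  rewrite [LHS]matrix_sum_delta; apply: eq_bigr => i _; apply: eq_bigr => j _.
  congr (_ *: _); apply/matrixP => i' j'.
  rewrite !mxE !coord_free ?(basis_free (vbasisP _)) // -natrM mulnb.
  by rewrite [i == _]eq_sym [j == _]eq_sym.
rewrite -[f _]/(F _) -[h _]/(H _) !linear_sum; apply: eq_bigr => i _.
rewrite !linear_sum; apply: eq_bigr => j _; rewrite !linearZ /=.
by congr (_ *: _); apply: fh.
Qed.

End TensorVector.

Section TensorAlgebra.
Variables (K : fieldType) (A B : falgType K).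
Implicit Types x y z : tensor A B.

Definition tensor_mul x y : tensor A B :=
  tensor_lift (fun a b => tensor_lift (fun a' b' => tens (a * a') (b * b')) y) x.

Lemma tensor_mul_linearl y : linear (tensor_mul^~ y).
Proof. exact: tensor_lift_linear. Qed.

Lemma tensor_mul_linearr x : linear (tensor_mul x).
Proof.
move=> c y z; rewrite /tensor_mul -tensor_lift_linear_fun.
by apply: eq_tensor_lift => a b; rewrite tensor_lift_linear.
Qed.

Lemma tensor_mul_tens (a a' : A) (b b' : B) :
  tensor_mul (tens a b) (tens a' b') = tens (a * a') (b * b').
Proof.
have inner u v : tensor_lift (fun a' b' => tens (u * a') (v * b')) (tens a' b')
    = tens (u * a') (v * b') :> tensor A B.
  apply: tensor_lift_tens => [w c w1 w2|w c w1 w2].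
    by rewrite mulrDr -scalerAr tens_linearr.
  by rewrite mulrDr -scalerAr tens_linearl.
rewrite /tensor_mul (eq_tensor_lift _ inner).
apply: (@tensor_lift_tens _ _ _ _ (fun u v => tens (u * a') (v * b')))
  => [w c w1 w2|w c w1 w2].
  by rewrite mulrDl -scalerAl tens_linearr.
by rewrite mulrDl -scalerAl tens_linearl.
Qed.

Lemma tensor_mulA : associative tensor_mul.
Proof.
move=> x y z; move: x; apply: tensor_ext => [c u v|c u v|a b].
- by rewrite tensor_mul_linearl.
- by rewrite !tensor_mul_linearl.
move: y; apply: tensor_ext => [c u v|c u v|a' b'].
- by rewrite tensor_mul_linearl tensor_mul_linearr.
- by rewrite tensor_mul_linearr tensor_mul_linearl.
move: z; apply: tensor_ext => [c u v|c u v|a2 b2].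
- by rewrite !tensor_mul_linearr.
- by rewrite tensor_mul_linearr.
by rewrite !tensor_mul_tens !mulrA.
Qed.

Lemma tensor_mul1 : left_id (tens 1 1) tensor_mul.
Proof.
apply: tensor_ext => [c u v|c u v|a b]; first by rewrite tensor_mul_linearr.
  by [].
by rewrite tensor_mul_tens !mul1r.
Qed.

Lemma tensor_mulr1 : right_id (tens 1 1) tensor_mul.
Proof.
apply: tensor_ext => [c u v|c u v|a b]; first by rewrite tensor_mul_linearl.
  by [].
by rewrite tensor_mul_tens !mulr1.
Qed.

Lemma tensor_mulDl : left_distributive tensor_mul +%R.
Proof.
by move=> x y z; have := tensor_mul_linearl z 1 x y; rewrite !scale1r.
Qed.

Lemma tensor_mulDr : right_distributive tensor_mul +%R.
Proof.
by move=> x y z; have := tensor_mul_linearr x 1 y z; rewrite !scale1r.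
Qed.

Lemma tensor_1_neq0 : (tens 1 1 : tensor A B) != 0.
Proof.
have nz (V : falgType K) : exists i, coord (vbasis {:V}) i 1 != 0.
  apply/existsP; rewrite -negb_forall; apply/forallP => v0.
  have /eqP[] := oner_neq0 V; rewrite (coord_vbasis (memvf 1)).
  by rewrite big1 // => i _; rewrite (eqP (v0 i)) scale0r.
have [[i ai] [j bj]] := (nz A, nz B).
apply/eqP => /(congr1 (fun M : 'M[K]_(\dim {:A}, \dim {:B}) => M i j)) /eqP.
by rewrite /tens !mxE mulf_eq0 (negPf ai) (negPf bj).
Qed.

HB.instance Definition _ := GRing.Zmodule_isNzRing.Build (tensor A B)
  tensor_mulA tensor_mul1 tensor_mulr1 tensor_mulDl tensor_mulDr tensor_1_neq0.

Lemma tensor_scalerAl (c : K) x y : c *: (x * y) = (c *: x) * y.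
Proof.
have y0 : tensor_mul 0 y = 0 := mul0r y.
by have := tensor_mul_linearl y c x 0; rewrite !addr0 y0 addr0 => <-.
Qed.

HB.instance Definition _ :=
  GRing.Lmodule_isLalgebra.Build K (tensor A B) tensor_scalerAl.

Lemma tensor_scalerAr (c : K) x y : c *: (x * y) = x * (c *: y).
Proof.
have x0 : tensor_mul x 0 = 0 := mulr0 x.
by have := tensor_mul_linearr x c y 0; rewrite !addr0 x0 addr0 => <-.
Qed.

HB.instance Definition _ :=
  GRing.Lalgebra_isAlgebra.Build K (tensor A B) tensor_scalerAr.
HB.instance Definition _ := Algebra_isFalgebra.Build K (tensor A B).

Lemma tensM (a a' : A) (b b' : B) :
  (tens a b : tensor A B) * tens a' b' = tens (a * a') (b * b').
Proof. exact: tensor_mul_tens. Qed.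

Lemma tens1 : tens 1 1 = 1 :> tensor A B.
Proof. by []. Qed.

End TensorAlgebra.

Definition structure_constant (K : fieldType) (A : falgType K) n
    (B : n.-tuple A) (i j h : 'I_n) : K :=
  coord B h (tnth B i * tnth B j).

(* [delta] is the valency homomorphism. In R[i], [0 <= z] says that z is a   *)
(* nonnegative real.                                                         *)
Record symmetric_rank3_SITA (R : realType) (A : falgType R[i])
    (B : 3.-tuple A) (delta : {lrmorphism A -> R[i] | *%R}) : Prop := {
  sita_comm : commutative (@GRing.mul A);
  sita_basis : basis_of fullv B;
  sita_1 : tnth B ord0 = 1;
  sita_ge0 : forall i j h, 0 <= structure_constant B i j h;
  sita_neq : forall i j, i != j -> structure_constant B i j ord0 = 0;
  sita_eq : forall i, structure_constant B i i ord0 = delta (tnth B i);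
  sita_int : forall i, exists2 m : nat, (0 < m)%N & delta (tnth B i) = m%:R
}.

(* The irreducible characters of a commutative algebra are its algebra       *)
(* homomorphisms to the scalars; each of them labels exactly one row of the  *)
(* table, and the first row is delta.                                        *)
Definition is_character_table (R : realType) (A : falgType R[i])
    (B : 3.-tuple A) (delta : {lrmorphism A -> R[i] | *%R})
    (P : 'M[R[i]]_3) : Prop :=
  exists chi : 'I_3 -> {lrmorphism A -> R[i] | *%R},
    [/\ chi ord0 =1 delta,
        forall i j, chi i =1 chi j -> i = j,
        forall f : {lrmorphism A -> R[i] | *%R}, exists i, f =1 chi i
      & forall i j, P i j = chi i (tnth B j)].

Definition mx_of_rows (K : nzRingType) m n (s : seq (seq K)) : 'M[K]_(m, n) :=
  \matrix_(i < m, j < n) (nth [::] s i)`_j.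

(* C_(3j+i+1) = A_i (x) A_j, for 1 <= t <= 9. *)
Definition tensor_sq_basis (K : fieldType) (A : falgType K) (B : 3.-tuple A)
    (t : nat) : tensor A A :=
  tens B`_(t.-1 %% 3) B`_(t.-1 %/ 3).

Definition is_partition_2_9 (tau : seq (seq nat)) : bool :=
  ([::] \notin tau) && perm_eq (flatten tau) (iota 2 8).

Definition fusion_space (K : fieldType) (A : falgType K) (B : 3.-tuple A)
    (tau : seq (seq nat)) : {vspace tensor A A} :=
  <<tensor_sq_basis B 1 ::
    [seq (\sum_(t <- T) tensor_sq_basis B t)%R | T <- tau]>>%VS.

Definition gives_fusion (K : fieldType) (A : falgType K) (B : 3.-tuple A)
    (tau : seq (seq nat)) : Prop :=
  is_partition_2_9 tau /\
  {in fusion_space B tau &, forall x y, x * y \in fusion_space B tau}.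

(* Main.v *)
Require Import Defs.
From HB Require Import structures.
From mathcomp Require Import all_boot all_order all_algebra all_field.
From mathcomp Require Import reals complex.
From mathcomp Require Import ring.
Set Implicit Arguments.
Unset Strict Implicit.
Unset Printing Implicit Defensive.
Import Order.TTheory GRing.Theory Num.Theory.
Local Open Scope ring_scope.

(** In case (ii), with [m = 1 + r], the character table is that of the lattice
graph on [(m + 1)^2] points, i.e. of the Hamming scheme H(2, m + 1); in case
(i), with [m = - s], it is the same table with [A_1] and [A_2] exchanged. The
tensor square of H(2, q) fuses to the Hamming scheme H(4, q): the block sums
are the distance-i elements, and multiplication by the distance-1 element X
follows the three-term recurrence
  [D_i X = (4 - i + 1) m D_(i-1) + i (m - 1) D_i + (i + 1) D_(i+1)].
Hence the span is stable under X, and every block sum is a polynomial in X. *)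

Section HammingFusion.
Variables (K : numFieldType) (A : falgType K) (a b : A) (m : K).
Hypothesis aa : a * a = (2 * m) *: 1 + (m - 1) *: a + 2 *: b.
Hypothesis ba : b * a = m *: a + (2 * m - 2) *: b.

(** In a product of two copies of H(2, m + 1) distances add, so [D1], ..., [D4] collect the products
    of [1], [a], [b] (distances 0, 1, 2) by total distance. *)
Let D1 : tensor A A := tens a 1 + tens 1 a.
Let D2 : tensor A A := tens b 1 + tens 1 b + tens a a.
Let D3 : tensor A A := tens b a + tens a b.
Let D4 : tensor A A := tens b b.

Let tensE := (mulrDl, mulrDr, tensM, mulr1, mul1r, aa, ba).

Lemma hamming_mul11 : D1 * D1 = (4 * m) *: 1 + (m - 1) *: D1 + 2 *: D2.
Proof.
(* Tensors are coordinate matrices, so after expansion by [aa] and [ba] each entry is a commutative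
   ring identity between scalars. *)
rewrite -tens1 /D1 /D2 !tensE; apply/matrixP => i j.
by rewrite !mxE !linearD !linearZ /=; ring.
Qed.

Lemma hamming_mul21 :
  D2 * D1 = (3 * m) *: D1 + (2 * (m - 1)) *: D2 + 3 *: D3.
Proof.
rewrite /D1 /D2 /D3 !tensE; apply/matrixP => i j.
by rewrite !mxE !linearD !linearZ /=; ring.
Qed.

Lemma hamming_mul31 :
  D3 * D1 = (2 * m) *: D2 + (3 * (m - 1)) *: D3 + 4 *: D4.
Proof.
rewrite /D1 /D2 /D3 /D4 !tensE; apply/matrixP => i j.
by rewrite !mxE !linearD !linearZ /=; ring.
Qed.

Lemma hamming_mul41 : D4 * D1 = m *: D3 + (4 * (m - 1)) *: D4.
Proof.
rewrite /D1 /D3 /D4 !tensE; apply/matrixP => i j.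
by rewrite !mxE !linearD !linearZ /=; ring.
Qed.

Lemma hamming_span_closed :
  {in <<[:: 1%R; D1; D2; D3; D4]>>%VS &,
     forall x y, x * y \in <<[:: 1%R; D1; D2; D3; D4]>>%VS}.
Proof.
set S := <<_>>%VS.
have [S0 S1 S2 S3 S4] : [/\ 1 \in S, D1 \in S, D2 \in S, D3 \in S & D4 \in S].
  by split; apply: memv_span; rewrite !inE eqxx ?orbT.
have SD c d x y : x \in S -> y \in S -> c *: x + d *: y \in S.
  by move=> xS yS; rewrite memvD ?memvZ.
have stab y : (forall x, x \in [:: 1; D1; D2; D3; D4] -> x * y \in S) ->
    forall x, x \in S -> x * y \in S.
  move=> yS x /coord_span ->; rewrite mulr_suml memv_suml // => i _.
  by rewrite -scalerAl memvZ // yS // mem_nth.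
have stab1 : forall x, x \in S -> x * D1 \in S.
  apply: stab => x; rewrite !inE => /or4P[||| /orP[|]] /eqP->.
  - by rewrite mul1r.
  - by rewrite hamming_mul11 !memvD ?memvZ.
  - by rewrite hamming_mul21 !memvD ?memvZ.
  - by rewrite hamming_mul31 !memvD ?memvZ.
  - by rewrite hamming_mul41 !memvD ?memvZ.
(* The recurrence is solved for its last term: the coefficient [n.+1] is invertible in
   characteristic zero, so stability passes from [u], [y] and [E] to [z]. *)
have solve (n : nat) (u y z : tensor A A) (c d : K) (E : tensor A A) :
    E = c *: u + d *: y + n.+1%:R *: z -> forall x, x * E \in S ->
    x * u \in S -> x * y \in S -> x * z \in S.
  move=> -> x; rewrite !mulrDr -!scalerAr => ES uS yS.
  have zS : n.+1%:R *: (x * z) \in S by rewrite -(rpredDl _ (SD c d _ _ uS yS)).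
  by rewrite -[x * z](@scalerK _ _ n.+1%:R) ?pnatr_eq0 // memvZ.
have stab2 x : x \in S -> x * D2 \in S.
  move=> xS; apply: (solve _ _ _ _ _ _ _ hamming_mul11).
  - by rewrite mulrA !stab1.
  - by rewrite mulr1.
  - exact: stab1.
have stab3 x : x \in S -> x * D3 \in S.
  move=> xS; apply: (solve _ _ _ _ _ _ _ hamming_mul21).
  - by rewrite mulrA stab1 ?stab2.
  - exact: stab1.
  - exact: stab2.
have stab4 x : x \in S -> x * D4 \in S.
  move=> xS; apply: (solve _ _ _ _ _ _ _ hamming_mul31).
  - by rewrite mulrA stab1 ?stab3.
  - exact: stab2.
  - exact: stab3.
move=> x y xS /coord_span ->; rewrite mulr_sumr memv_suml // => i _.
rewrite -scalerAr memvZ //.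
have : [:: 1; D1; D2; D3; D4]`_i \in [:: 1; D1; D2; D3; D4] by rewrite mem_nth.
rewrite !inE => /or4P[||| /orP[|]] /eqP->; rewrite ?mulr1 //.
- exact: stab1.
- exact: stab2.
- exact: stab3.
- exact: stab4.
Qed.

End HammingFusion.

(** * Characters of a rank 3 algebra *)

Section Rank3.
Variables (K : fieldType) (A : falgType K) (B : 3.-tuple A).
Hypothesis basisB : basis_of fullv B.
Hypothesis B1 : tnth B ord0 = 1.

Lemma rank3_coord (x : A) : exists c0 c1 c2,
  x = c0 *: 1 + c1 *: B`_1 + c2 *: B`_2.
Proof.
exists (coord B ord0 x), (coord B (lift ord0 ord0) x),
  (coord B (lift ord0 (lift ord0 ord0)) x).
by rewrite {1}(coord_basis basisB (memvf x)) !big_ord_recl big_ord0 addr0 addrA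
  -B1 (tnth_nth 0).
Qed.

Variables (k l r s : K) (chi : 'I_3 -> {lrmorphism A -> K | *%R}).
Hypothesis chi_inj : forall i j, chi i =1 chi j -> i = j.
Hypothesis chiB : forall i j,
  mx_of_rows 3 3 [:: [:: 1; k; l]; [:: 1; r; - 1 - r]; [:: 1; s; - 1 - s]] i j
  = chi i (tnth B j).

Let o1 : 'I_3 := lift ord0 ord0.
Let o2 : 'I_3 := lift ord0 (lift ord0 ord0).

Lemma rank3_chiE :
  ((chi ord0 B`_1 = k) * (chi ord0 B`_2 = l) *
  (chi o1 B`_1 = r) * (chi o1 B`_2 = - 1 - r) *
  (chi o2 B`_1 = s) * (chi o2 B`_2 = - 1 - s))%type.
Proof.
have E i j := esym (chiB i j).
have := (E ord0 o1, E ord0 o2, E o1 o1, E o1 o2, E o2 o1, E o2 o2).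
by rewrite !mxE !(tnth_nth 0).
Qed.

(** Otherwise the last two rows coincide, and two distinct characters agree on a basis. *)
Lemma rank3_eigenvalues_neq : r != s.
Proof.
apply/eqP => rs; suff /chi_inj : chi o1 =1 chi o2 by [].
move=> x; have [c0 [c1 [c2 ->]]] := rank3_coord x.
by rewrite !linearD !linearZ /= !rmorph1 !rank3_chiE rs.
Qed.

(* The character table has determinant [(1 + k + l) (s - r)] up to sign. *)
Lemma rank3_char_separate : 1 + k + l != 0 ->
  forall x y, (forall i, chi i x = chi i y) -> x = y.
Proof.
move=> n0 x y xy; apply/eqP; rewrite -subr_eq0; apply/eqP.
have: forall i, chi i (x - y) = 0 by move=> i; rewrite rmorphB /= xy subrr.
have [c0 [c1 [c2 ->]]] := rank3_coord (x - y) => z0.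
have := (z0 ord0, z0 o1, z0 o2).
rewrite !linearD !linearZ /= !rmorph1 !rank3_chiE !mulr1 => -[[e0 e1] e2].
(* Subtracting the last two character equations eliminates [c0]. *)
have /eqP : (c1 - c2) * (r - s) = 0.
  have -> : (c1 - c2) * (r - s) = (c0 + c1 * r + c2 * (- 1 - r)) -
      (c0 + c1 * s + c2 * (- 1 - s)) by ring.
  by rewrite e1 e2 subrr.
rewrite mulf_eq0 [r - s == 0]subr_eq0 (negPf rank3_eigenvalues_neq) orbF.
rewrite subr_eq0 => /eqP c12.
(* With [c1 = c2], equation [e1] collapses to [c0 - c2 = 0], because its row sums to zero. *)
have c02 : c0 = c2.
  by apply/eqP; rewrite -subr_eq0 -e1 c12; apply/eqP; ring.
have /eqP : c2 * (1 + k + l) = 0 by rewrite -e0 c12 c02; ring.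
rewrite mulf_eq0 (negPf n0) orbF => /eqP c20.
by rewrite c02 c12 c20 !scale0r !addr0.
Qed.

End Rank3.

(** * Indices, labels and the two fusions *)

Lemma forall_ord3 (P : 'I_3 -> Prop) : P ord0 -> P (lift ord0 ord0) ->
  P (lift ord0 (lift ord0 ord0)) -> forall i, P i.
Proof.
by move=> P0 P1 P2 [[|[|[|//]]] ilt];
  [move: P0 | move: P1 | move: P2]; congr P; apply: val_inj.
Qed.

Lemma tensor_sq_basisE (K : fieldType) (A : falgType K) (B : 3.-tuple A) :
  B`_0 = 1 ->
  ((tensor_sq_basis B 1 = 1) *
   (tensor_sq_basis B 2 = tens B`_1 1) * (tensor_sq_basis B 3 = tens B`_2 1) *
   (tensor_sq_basis B 4 = tens 1 B`_1) * (tensor_sq_basis B 5 = tens B`_1 B`_1) *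
   (tensor_sq_basis B 6 = tens B`_2 B`_1) * (tensor_sq_basis B 7 = tens 1 B`_2) *
   (tensor_sq_basis B 8 = tens B`_1 B`_2) *
   (tensor_sq_basis B 9 = tens B`_2 B`_2))%type.
Proof.
move=> B0; have C i j : (i < 3)%N ->
    tensor_sq_basis B (j * 3 + i).+1 = tens B`_i B`_j.
  by move=> i3; rewrite /tensor_sq_basis /= modnMDl divnMDl // modn_small //
    divn_small // addn0.
rewrite -tens1 -B0; exact: (C 0 0 isT, C 1 0 isT, C 2 0 isT, C 0 1 isT,
  C 1 1 isT, C 2 1 isT, C 0 2 isT, C 1 2 isT, C 2 2 isT)%N.
Qed.

Theorem theorem4p4 (R : realType) (A : falgType R[i]) (B : 3.-tuple A)
    (delta : {lrmorphism A -> R[i] | *%R}) (k l r s : R[i])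
    (hA : symmetric_rank3_SITA B delta)
    (hP : is_character_table B delta
            (mx_of_rows 3 3 [:: [:: 1; k; l];
                                [:: 1; r; - 1 - r];
                                [:: 1; s; - 1 - s]])) :
  (k = s ^+ 2 -> l = - 2 * s -> r = 1 ->
   gives_fusion B [:: [:: 2; 4; 9]; [:: 3; 7]; [:: 5]; [:: 6; 8]]%N)
  /\
  (k = 2 * (1 + r) -> l = (1 + r) ^+ 2 -> s = - 2 ->
   gives_fusion B [:: [:: 2; 4]; [:: 3; 7; 5]; [:: 6; 8]; [:: 9]]%N).
Proof.
have [_ basisB B1 _ _ _ _] := hA; have [chi [_ chi_inj _ chiB]] := hP.
have chiE := rank3_chiE chiB.
have rs := rank3_eigenvalues_neq basisB B1 chi_inj chiB.
have sep := rank3_char_separate basisB B1 chi_inj chiB.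
have B0 : B`_0 = 1 by rewrite -B1 (tnth_nth 0).
split=> [kE lE rE | kE lE sE]; split=> //.
(* In both cases [1 + k + l] is the square of [r - s], hence nonzero, and the characters separate
   points. *)
- have /sep {}sep : 1 + k + l != 0.
    have -> : 1 + k + l = (r - s) ^+ 2 by rewrite kE lE rE; ring.
    by rewrite expf_neq0 // subr_eq0.
  have aa : B`_2 * B`_2 = (2 * - s) *: 1 + (- s - 1) *: B`_2 + 2 *: B`_1.
    apply: sep; apply: forall_ord3;
      rewrite rmorphM /= !linearD !linearZ /= rmorph1 !chiE ?kE ?lE ?rE; ring.
  have ba : B`_1 * B`_2 = - s *: B`_2 + (2 * - s - 2) *: B`_1.
    apply: sep; apply: forall_ord3;
      rewrite rmorphM /= !linearD !linearZ /= !chiE ?kE ?lE ?rE; ring.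
  pose D1 : tensor A A := tens B`_2 1 + tens 1 B`_2.
  pose D2 : tensor A A := tens B`_1 1 + tens 1 B`_1 + tens B`_2 B`_2.
  pose D3 : tensor A A := tens B`_1 B`_2 + tens B`_2 B`_1.
  pose D4 : tensor A A := tens B`_1 B`_1.
  rewrite /fusion_space /= !big_cons !big_nil !(tensor_sq_basisE B0) !addr0.
  rewrite addrA [tens B`_2 B`_1 + _]addrC -/D1 -/D2 -/D3 -/D4.
  (* The blocks [249|37|5|68] list the distances in the order 2, 1, 4, 3; a span depends only on the
     set of its generators. *)
  have swap (V : vectType R[i]) (e x y z w : V) :
      <<[:: e; y; x; w; z]>>%VS = <<[:: e; x; y; z; w]>>%VS.
    by apply: eq_span => v; rewrite !inE; case: (v == e); case: (v == x);
      case: (v == y); case: (v == z); case: (v == w).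
  rewrite swap.
  exact: hamming_span_closed aa ba.
- have /sep {}sep : 1 + k + l != 0.
    have -> : 1 + k + l = (r - s) ^+ 2 by rewrite kE lE sE; ring.
    by rewrite expf_neq0 // subr_eq0.
  have aa : B`_1 * B`_1 =
      (2 * (1 + r)) *: 1 + (1 + r - 1) *: B`_1 + 2 *: B`_2.
    apply: sep; apply: forall_ord3;
      rewrite rmorphM /= !linearD !linearZ /= rmorph1 !chiE ?kE ?lE ?sE; ring.
  have ba : B`_2 * B`_1 = (1 + r) *: B`_1 + (2 * (1 + r) - 2) *: B`_2.
    apply: sep; apply: forall_ord3;
      rewrite rmorphM /= !linearD !linearZ /= !chiE ?kE ?lE ?sE; ring.
  (* The blocks [24|375|68|9] already come in order of distance, so only the sum over [375] has to
     be reassociated. *)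
  have := hamming_span_closed aa ba.
  rewrite /fusion_space /= !big_cons !big_nil !(tensor_sq_basisE B0) !addr0.
  by rewrite addrA.
Qed.
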